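(* For every $n\ge 3$ the family $\mathcal{R}_n$ is generic in the variety $\mathfrak{Nil}_n$ of all $n$-dimensional complex nilpotent algebras, i.e. $\overline{\bigcup_{\mathcal{A}\in\mathcal{R}_n}O(\mathcal{A})}=\mathfrak{Nil}_n$. Moreover, for every $n\ge 2$ the variety $\mathfrak{Nil}_n$ is irreducible and $\dim \mathfrak{Nil}_n=\frac{n(n-1)(n+1)}{3}$.
   Context: All algebras are over $\mathbb{C}$ and not necessarily associative (a vector space with a bilinear product). Fix an $n$-dimensional vector space $V$ with basis $e_1,\dots,e_n$; an algebra structure on $V$ is identified with the point $(c_{ij}^k)_{i,j,k=1}^n\in\mathbb{C}^{n^3}$ of its structure constants, $e_ie_j=\sum_k c_{ij}^k e_k$, with the Zariski topology. $\mathrm{GL}_n(\mathbb{C})$ acts by change of basis; $O(\mathcal{A})$ is the orbit of $\mathcal{A}$ (its isomorphism class). An algebra $N$ is nilpotent if $N^k=0$ for some $k$, where $N^1=N$, $N^{k+1}=\sum_{i=1}^k N^iN^{k+1-i}$. $\mathfrak{Nil}_n\subseteq\mathbb{C}^{n^3}$ is the (closed) set of nilpotent structures. A family $\mathcal{R}$ of algebras in an irreducible variety $\mathfrak{V}$ is generic if $\overline{\bigcup_{\mathcal{A}\in\mathcal{R}}O(\mathcal{A})}=\mathfrak{V}$. Condition ( * ): $c_{ij}^k=0$ whenever $k\le\max\{i,j\}$. For $n\ge3$, $\mathcal{R}_n$ is the family of algebra structures on $V$ satisfying ( * ) such that $e_i^2=e_{i+1}$ for $1\le i\le n-1$ (i.e.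 $c_{ii}^k=\delta_{k,i+1}$), $c_{21}^3=1$, $c_{1i}^{i+1}=0$ for $2\le i\le n-1$, and whose remaining structure constants $c_{ij}^k$ ($i\ne j$, $k>\max\{i,j\}$) are arbitrary independent complex parameters. *)

(* Defs.v *)
(* The ground field C = R[i] for an arbitrary R : realType
   (every realType is a model of the real numbers, so C is the field of
   complex numbers). *)
From HB Require Import structures.
From mathcomp Require Import all_boot all_order all_algebra.
From mathcomp Require Import reals complex.
From mathcomp Require Import mpoly.
Set Implicit Arguments. Unset Strict Implicit. Unset Printing Implicit Defensive.
Import Order.TTheory GRing.Theory Num.Theory.
Local Open Scope ring_scope.

(* An algebra structure on V = C^n, given by its structure constants:
   c i j k = c_{ij}^k, i.e. e_i e_j = \sum_k c_{ij}^k e_k  (indices 0-based). *)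
Definition strc (R : realType) (n : nat) := 'I_n -> 'I_n -> 'I_n -> complex R.

Definition sset (R : realType) (n : nat) := strc R n -> Prop.

Definition coord3 (n : nat) : finType := ('I_n * 'I_n * 'I_n)%type.

Definition coords (R : realType) (n : nat) (c : strc R n) :
  'I_#|{: coord3 n}| -> complex R :=
  fun m => let: (i, j, k) := enum_val m in c i j k.

Definition zclosed (R : realType) (n : nat) (S : sset R n) : Prop :=
  exists P : {mpoly complex R[#|{: coord3 n}|]} -> Prop,
    forall c, S c <-> (forall p, P p -> p.@[coords c] = 0).

Definition zclosure (R : realType) (n : nat) (A : sset R n) : sset R n :=
  fun c => forall S, zclosed S -> (forall d, A d -> S d) -> S c.

Definition ssubset (R : realType) (n : nat) (A B : sset R n) : Prop :=
  forall c, A c -> B c.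

Definition zirreducible (R : realType) (n : nat) (V : sset R n) : Prop :=
  (exists c, V c) /\
  forall V1 V2, zclosed V1 -> zclosed V2 ->
    ssubset V (fun c => V1 c \/ V2 c) -> ssubset V V1 \/ ssubset V V2.

Definition irr_chain (R : realType) (n : nat) (V : sset R n) (d : nat) : Prop :=
  exists Z : nat -> sset R n,
    (forall i, (i <= d)%N -> [/\ zclosed (Z i), zirreducible (Z i) & ssubset (Z i) V]) /\
    (forall i, (i < d)%N -> ssubset (Z i) (Z i.+1) /\ ~ ssubset (Z i.+1) (Z i)).

Definition zdim (R : realType) (n : nat) (V : sset R n) (d : nat) : Prop :=
  irr_chain V d /\ ~ irr_chain V d.+1.

Definition mulv (R : realType) (n : nat) (c : strc R n) (u v : 'rV[complex R]_n)
  : 'rV[complex R]_n :=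
  \row_k \sum_(i < n) \sum_(j < n) u 0 i * v 0 j * c i j k.

(* span of all products of elements of the row spaces of A and B
   (by bilinearity: the span of products of their rows) *)
Definition prodsp (R : realType) (n : nat) (c : strc R n) (A B : 'M[complex R]_n)
  : 'M[complex R]_n :=
  (\sum_(a < n) \sum_(b < n) <<mulv c (row a A) (row b B)>>)%MS.

(* pows c k = [:: N^1; ...; N^(k+1)] with N^1 = N and
   N^(m+1) = \sum_(i=1..m) N^i N^(m+1-i) *)
Fixpoint pows (R : realType) (n : nat) (c : strc R n) (k : nat)
  : seq 'M[complex R]_n :=
  match k with
  | 0 => [:: 1%:M]
  | k'.+1 => let s := pows c k' in
      rcons s (\sum_(i < k'.+1) prodsp c (nth 0 s i) (nth 0 s (k' - i)))%MS
  end.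

(* N^m for m >= 1 *)
Definition npow (R : realType) (n : nat) (c : strc R n) (m : nat) : 'M[complex R]_n :=
  nth 0 (pows c m.-1) m.-1.

Definition nilpotent (R : realType) (n : nat) (c : strc R n) : Prop :=
  exists k, (0 < k)%N /\ (npow c k == (0 : 'M[complex R]_n))%MS.

Definition NilV (R : realType) (n : nat) : sset R n := fun c => nilpotent c.

Definition orbit (R : realType) (n : nat) (c : strc R n) : sset R n :=
  fun d => exists g : 'M[complex R]_n, g \in unitmx /\
    forall u v, mulv d (u *m g) (v *m g) = mulv c u v *m g.

Definition Rfam (R : realType) (n : nat) : sset R n :=
  fun c =>
    [/\ (forall i j k : 'I_n, (k <= maxn i j)%N -> c i j k = 0),
        (forall i k : 'I_n, (i.+1 < n)%N -> c i i k = (k == i.+1 :> nat)%:R),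
        (forall i j k : 'I_n, i = 1%N :> nat -> j = 0%N :> nat -> k = 2%N :> nat ->
             c i j k = 1) &
        (forall h i k : 'I_n, h = 0%N :> nat -> (1 <= i)%N -> (i.+1 < n)%N ->
             (k = i.+1 :> nat) -> c h i k = 0)].

Definition generic (R : realType) (n : nat) (F V : sset R n) : Prop :=
  forall c, zclosure (fun d => exists a, F a /\ orbit a d) c <-> V c.

(* Main.v *)
(* Every nilpotent algebra has a basis satisfying the condition c_ij^k = 0 for
   k <= max(i,j), so Nil_n is the GL_n-saturation of the linear space T of such
   structures; it is closed because nilpotency means that all words of length n in
   the left and right multiplications vanish.  By Gauss factorization the polynomial
   map phi : (u, t) |-> u.t, with u lower unitriangular and t in T, has dense image
   in Nil_n.  It has n(n-1)/2 + sum_k (k-1)^2 = n(n-1)(n+1)/3 parameters, which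
   gives irreducibility.  Density and genericity are checked along polynomial curves:
   a regular function vanishing at all but finitely many points of one vanishes on it.

   Genericity: for t outside a hypersurface of T, put b_1 = x and b_(i+1) = b_i^2;
   the conditions of R_n on this basis become a triangular linear system for x.

   Dimension, lower bound: switch on the parameters of phi one by one, first those
   of t, then the columns of u in order.  The closures of the images increase
   strictly, the new parameter u_jk being detected by the j-th coordinate of the
   left-normed power e_1^k.  Upper bound: if Z_0 < ... < Z_d are closed irreducible
   and f_i vanishes on Z_(i-1) but not on Z_i, the monomials in the f_i are linearly
   independent on Z_d; pulled back along phi they are too many if d > dim. *)
Require Import Defs.
From HB Require Import structures.
From mathcomp Require Import all_boot all_order all_algebra.
From mathcomp Require Import reals complex.
From mathcomp Require Import mpoly.
From mathcomp Require Import zify ring.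
From Stdlib Require Import Classical FunctionalExtensionality PropExtensionality.
Set Implicit Arguments. Unset Strict Implicit. Unset Printing Implicit Defensive.
Import Order.TTheory GRing.Theory Num.Theory.

(** * Polynomial functions and Zariski closed sets *)

Section PolynomialFunctions.
Local Open Scope ring_scope.
Variable R : realType.
Local Notation C := (complex R).

(** Regular functions of a structure and polynomial functions of a curve parameter both form such a
    class; polynomiality of determinants, adjugates, products and [phi] is thus proved once for
    both. *)
Record funalg (X : Type) (P : (X -> C) -> Prop) : Prop := FunAlg {
  fa_ext : forall f g, f =1 g -> P f -> P g;
  fa_const : forall a, P (fun _ => a);
  fa_add : forall f g, P f -> P g -> P (fun x => f x + g x);
  fa_mul : forall f g, P f -> P g -> P (fun x => f x * g x)}.

Section FunAlgTheory.
Variables (X : Type) (P : (X -> C) -> Prop) (faP : funalg P).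

Lemma fa_sum (I : Type) (r : seq I) (Q : pred I) (F : I -> X -> C) :
  (forall i, P (F i)) -> P (fun x => \sum_(i <- r | Q i) F i x).
Proof.
move=> PF; elim: r => [|i r IH].
  by apply: (fa_ext faP) (fa_const faP 0) => x; rewrite big_nil.
case Qi: (Q i); last by apply: (fa_ext faP) IH => x; rewrite big_cons Qi.
by apply: (fa_ext faP) (fa_add faP (PF i) IH) => x; rewrite big_cons Qi.
Qed.

Lemma fa_prod (I : Type) (r : seq I) (Q : pred I) (F : I -> X -> C) :
  (forall i, P (F i)) -> P (fun x => \prod_(i <- r | Q i) F i x).
Proof.
move=> PF; elim: r => [|i r IH].
  by apply: (fa_ext faP) (fa_const faP 1) => x; rewrite big_nil.
case Qi: (Q i); last by apply: (fa_ext faP) IH => x; rewrite big_cons Qi.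
by apply: (fa_ext faP) (fa_mul faP (PF i) IH) => x; rewrite big_cons Qi.
Qed.

Lemma fa_exp f k : P f -> P (fun x => f x ^+ k).
Proof.
move=> Pf; elim: k => [|k IH].
  by apply: (fa_ext faP) (fa_const faP 1).
by apply: (fa_ext faP) (fa_mul faP Pf IH) => x; rewrite exprS.
Qed.

Lemma fa_meval N (co : X -> 'I_N -> C) (p : {mpoly C[N]}) :
  (forall i, P (co^~ i)) -> P (fun x => p.@[co x]).
Proof.
move=> Pco; apply: (fa_ext faP (f := fun x =>
   \sum_(m <- msupp p) p@_m * \prod_i co x i ^+ m i)) => [x|].
  by rewrite mevalE.
apply: fa_sum => m; apply: (fa_mul faP); first exact: (fa_const faP).
by apply: fa_prod => i; apply: fa_exp.
Qed.

Lemma fa_det n (A : X -> 'M[C]_n) :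
  (forall i j, P (fun x => A x i j)) -> P (fun x => \det (A x)).
Proof.
move=> PA; apply: fa_sum => s; apply: (fa_mul faP); first exact: (fa_const faP).
by apply: fa_prod => i.
Qed.

Lemma fa_adj n (A : X -> 'M[C]_n) i j :
  (forall i j, P (fun x => A x i j)) -> P (fun x => (\adj (A x)) i j).
Proof.
move=> PA; apply: (fa_ext faP (f := fun x => cofactor (A x) j i)) => [x|].
  by rewrite mxE.
apply: (fa_mul faP); first exact: (fa_const faP).
apply: fa_det => k l; apply: (fa_ext faP) (PA (lift j k) (lift i l)) => x.
by rewrite !mxE.
Qed.

Lemma fa_mulmx m n p (A : X -> 'M[C]_(m, n)) (B : X -> 'M[C]_(n, p)) i j :
  (forall i j, P (fun x => A x i j)) -> (forall i j, P (fun x => B x i j)) ->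
  P (fun x => (A x *m B x) i j).
Proof.
move=> PA PB; apply: (fa_ext faP (f := fun x => \sum_k A x i k * B x k j)) => [x|].
  by rewrite mxE.
by apply: fa_sum => k; apply: (fa_mul faP).
Qed.

Lemma fa_mulv n (c : X -> strc R n) (u v : X -> 'rV[C]_n) k :
  (forall i j k, P (fun x => c x i j k)) -> (forall i, P (fun x => u x 0 i)) ->
  (forall i, P (fun x => v x 0 i)) -> P (fun x => mulv (c x) (u x) (v x) 0 k).
Proof.
move=> Pc Pu Pv; apply: (fa_ext faP (f := fun x =>
  \sum_i \sum_j u x 0 i * v x 0 j * c x i j k)) => [x|]; first by rewrite mxE.
by apply: fa_sum => i; apply: fa_sum => j; apply: (fa_mul faP) => //; apply: (fa_mul faP).
Qed.

End FunAlgTheory.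

Definition mpolyfun N X (co : X -> 'I_N -> C) (f : X -> C) : Prop :=
  exists p : {mpoly C[N]}, forall x, f x = p.@[co x].

Lemma funalg_mpolyfun N X (co : X -> 'I_N -> C) : funalg (mpolyfun co).
Proof.
split=> [f g fg [p fE]|a|f g [p fE] [q gE]|f g [p fE] [q gE]].
- by exists p => x; rewrite -fg.
- by exists a%:MP => x; rewrite mevalC.
- by exists (p + q) => x; rewrite mevalD fE gE.
- by exists (p * q) => x; rewrite mevalM fE gE.
Qed.

Definition polyfun (f : C -> C) : Prop := exists p : {poly C}, forall s, f s = p.[s].

Lemma funalg_polyfun : funalg polyfun.
Proof.
split=> [f g fg [p fE]|a|f g [p fE] [q gE]|f g [p fE] [q gE]].
- by exists p => x; rewrite -fg.
- by exists a%:P => x; rewrite hornerC.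
- by exists (p + q) => x; rewrite hornerD fE gE.
- by exists (p * q) => x; rewrite hornerM fE gE.
Qed.

Lemma polyfun_line (a b : C) : polyfun (fun s => (1 - s) * a + s * b).
Proof.
by exists ((1 - 'X) * a%:P + 'X * b%:P) => s; rewrite !hornerE.
Qed.

Lemma horner_eq0P (p : {poly C}) : (forall s, p.[s] = 0) -> p = 0.
Proof.
move=> p0; apply/eqP; apply: contraT => pn0.
(* Characteristic zero: the integers 0, ..., [size p] - 1 are distinct roots, one too many. *)
pose rs := [seq i%:R : C | i <- iota 0 (size p)].
have : (size rs < size p)%N.
  apply: max_poly_roots pn0 _ _; first by apply/allP => s _; rewrite /root p0.
  by rewrite map_inj_uniq ?iota_uniq // => i j /eqP; rewrite eqr_nat => /eqP.
by rewrite size_map size_iota ltnn.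
Qed.

(** The product of [f] and [q] vanishes everywhere, and the polynomial ring is a domain. *)
Lemma polyfun_dense f q s0 : polyfun f -> polyfun q -> q s0 != 0 ->
  (forall s, q s != 0 -> f s = 0) -> forall s, f s = 0.
Proof.
move=> [p fE] [r qE] qs0 fq0 s.
have /eqP : p * r = 0.
  apply: horner_eq0P => x; rewrite hornerM -fE -qE.
  by have [->|/fq0 ->] := eqVneq (q x) 0; rewrite ?mulr0 ?mul0r.
rewrite mulf_eq0 => /orP[] /eqP p0; first by rewrite fE p0 horner0.
by move: qs0; rewrite qE p0 horner0 eqxx.
Qed.

(** * Zariski closure, irreducibility and independence of regular functions *)

Section Zariski.
Variable n : nat.
Implicit Types (c d : strc R n) (A B S : sset R n).

Definition regular (f : strc R n -> C) : Prop := mpolyfun (@coords R n) f.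

Lemma funalg_regular : funalg regular.
Proof. exact: funalg_mpolyfun. Qed.

Lemma regular_coord i j k : regular (fun c => c i j k).
Proof.
by exists 'X_(enum_rank ((i, j), k)) => c; rewrite mevalXU /coords enum_rankK.
Qed.

Lemma fa_regular X (P : (X -> C) -> Prop) (c : X -> strc R n) f :
  funalg P -> (forall i j k, P (fun x => c x i j k)) -> regular f ->
  P (fun x => f (c x)).
Proof.
move=> faP Pc [p fE]; apply: (fa_ext faP (f := fun x => p.@[coords (c x)])) => [x|].
  by rewrite fE.
by apply: fa_meval => // m; rewrite /coords; case: (enum_val m) => [[i j] k].
Qed.

(** The canonical equations are all regular functions vanishing on [S]; closedness proofs then need
    no explicit system of polynomials. *)
Lemma zclosedP S : zclosed S <->
  (forall c, (forall f, regular f -> (forall d, S d -> f d = 0) -> f c = 0) -> S c).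
Proof.
split=> [[P SP] c cS|SP].
  apply/SP => p Pp; apply: (cS (fun d => p.@[coords d])); first by exists p.
  by move=> d /SP; apply.
exists (fun p => forall d, S d -> p.@[coords d] = 0) => c; split=> [Sc p|cS].
  exact.
apply: SP => f [p fE] Sf; rewrite fE; apply: cS => d Sd.
by rewrite -fE Sf.
Qed.

Lemma zclosed_zero f : regular f -> zclosed (fun c => f c = 0).
Proof. by move=> rf; apply/zclosedP => c; apply. Qed.

Lemma zclosed_all (I : Type) (S : I -> sset R n) :
  (forall i, zclosed (S i)) -> zclosed (fun c => forall i, S i c).
Proof.
move=> clS; apply/zclosedP => c cS i; move/zclosedP: (clS i); apply=> f rf fS.
by apply: cS => // d /(_ i); apply: fS.
Qed.

Lemma zclosureP A c : zclosure A c <->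
  (forall f, regular f -> (forall d, A d -> f d = 0) -> f c = 0).
Proof.
split=> [Ac f rf fA|fA S clS AS].
  by apply: (Ac (fun d => f d = 0)) => //; apply: zclosed_zero.
by move/zclosedP: clS; apply=> f rf fS; apply: fA => // d /AS; apply: fS.
Qed.

Lemma zclosed_zclosure A : zclosed (zclosure A).
Proof.
apply/zclosedP => c cA; apply/zclosureP => f rf fA.
by apply: cA => // d /zclosureP; apply.
Qed.

Lemma subset_zclosure A : ssubset A (zclosure A).
Proof. by move=> c Ac S _; apply. Qed.

Lemma zclosure_min A S : zclosed S -> ssubset A S -> ssubset (zclosure A) S.
Proof. by move=> clS AS c; apply. Qed.

Lemma zclosed_sep S c : zclosed S -> ~ S c ->
  exists f, [/\ regular f, forall d, S d -> f d = 0 & f c <> 0].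
Proof.
move=> /zclosedP clS nSc; apply: NNPP => nex; apply: nSc; apply: clS => f rf fS.
by apply: NNPP => fc; apply: nex; exists f.
Qed.

Lemma not_ssubset A B : ~ ssubset A B -> exists2 c, A c & ~ B c.
Proof.
move=> nAB; apply: NNPP => nex; apply: nAB => c Ac; apply: NNPP => nBc.
by apply: nex; exists c.
Qed.

(** Let [f] vanish on [V1] but not at [x], and [g] on [V2] but not at [y]. Along a polynomial curve
    in [A] from [x] to [y], [f] vanishes wherever [g] does not, hence everywhere on the curve, which
    is absurd at [x]. *)
Lemma zirreducible_closure A : (exists c, A c) ->
  (forall x y, A x -> A y -> exists c : C -> strc R n,
     [/\ forall i j k, polyfun (fun s => c s i j k), forall s, A (c s),
       c 0 = x & c 1 = y]) ->
  zirreducible (zclosure A).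
Proof.
move=> [c0 Ac0] curve; split; first by exists c0; apply: subset_zclosure.
move=> V1 V2 cl1 cl2 AV; apply: NNPP => /not_or_and[n1 n2].
have sep V : zclosed V -> ~ ssubset (zclosure A) V ->
    exists f c, [/\ regular f, forall d, V d -> f d = 0, A c & f c <> 0].
  move=> clV nAV; have /not_ssubset[c Ac nVc] : ~ ssubset A V.
    by move=> AV'; apply: nAV; apply: zclosure_min.
  by have [f [rf fV fc]] := zclosed_sep clV nVc; exists f, c.
have [f [x [rf f0 Ax fx]]] := sep _ cl1 n1.
have [g [y [rg g0 Ay gy]]] := sep _ cl2 n2.
have [c [pc Ac c0x c1y]] := curve _ _ Ax Ay.
have pf := fa_regular funalg_polyfun pc rf.
have pg := fa_regular funalg_polyfun pc rg.
apply: fx; rewrite -c0x; apply: (polyfun_dense (s0 := 1) pf pg) => [|s].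
  by rewrite c1y; apply/eqP.
by have [/f0 ->|/g0 ->] := AV _ (subset_zclosure (Ac s)); rewrite ?eqxx.
Qed.

Definition lin_indep (I : finType) (G : I -> strc R n -> C) S : Prop :=
  forall a : I -> C, (forall c, S c -> \sum_i a i * G i c = 0) -> forall i, a i = 0.

(** Induction on the exponent k: once the coefficients of lower powers are 0, the relation on [S] is
    divisible by [f ^+ k], and this factor can be cancelled. On [A], where [f] is 0, only the terms
    of exponent k of the quotient survive, and independence of [G] on [A] applies. *)
Lemma lin_indep_powers (I : finType) (G : I -> strc R n -> C) f m A S :
  (forall i, regular (G i)) -> regular f -> zirreducible S -> ssubset A S ->
  (forall c, A c -> f c = 0) -> ~ (forall c, S c -> f c = 0) -> lin_indep G A ->
  lin_indep (fun (e : I * 'I_m) c => G e.1 c * f c ^+ e.2) S.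
Proof.
move=> rG rf irrS AS fA fS indG a a0.
suff H k : (k <= m)%N -> forall i (j : 'I_m), (j < k)%N -> a (i, j) = 0.
  by case=> i j; apply: (H m).
elim: k => [//|k IH] km i j; rewrite ltnS leq_eqVlt => /orP[/eqP jk|]; last first.
  by move=> jk; apply: IH => //; apply: ltnW.
pose tailf c := \sum_(e : I * 'I_m | (k <= e.2)%N) a e * (G e.1 c * f c ^+ (e.2 - k)).
have rtail : regular tailf.
  apply: (fa_sum funalg_regular) => e.
  apply: (fa_mul funalg_regular); first exact: (fa_const funalg_regular).
  by apply: (fa_mul funalg_regular) => //; apply: fa_exp => //; apply: funalg_regular.
have tail0 c : S c -> f c ^+ k * tailf c = 0.
  move=> Sc; rewrite -(a0 c Sc) mulr_sumr [RHS](bigID (fun e : I * 'I_m => (k <= e.2)%N)) /=.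
  rewrite [X in _ = _ + X]big1 ?addr0 => [|[i' j'] /=]; last first.
    by rewrite -ltnNge => j'k; rewrite IH ?mul0r // ltnW.
  apply: eq_bigr => e ke; rewrite mulrCA; congr (_ * _).
  by rewrite mulrCA -exprD subnKC.
(* The zero sets of [f] and [tailf] cover the irreducible set [S], and the first does not contain
   it. *)
have tailS c : S c -> tailf c = 0.
  have [_ /(_ (fun c => f c = 0) (fun c => tailf c = 0))] := irrS.
  case; [exact: zclosed_zero|exact: zclosed_zero| | |].
  - move=> c' /tail0 /eqP; rewrite mulf_eq0 expf_eq0 => /orP[/andP[_ /eqP]|/eqP]; by [left|right].
  - by move=> fS'; case: fS.
  - exact.
have : forall i, (fun i => a (i, j)) i = 0; last exact.
apply: indG => c Ac; rewrite -[RHS](tailS c (AS _ Ac)) /tailf.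
rewrite (eq_bigr (fun e => a (e.1, e.2) * (G e.1 c * f c ^+ (e.2 - k)))); last by case.
rewrite (bigID (fun e : I * 'I_m => e.2 == j)) /=.
rewrite [X in _ = _ + X]big1 ?addr0 => [|e /andP[ke ej]]; last first.
  rewrite fA // expr0n subn_eq0 leqNgt ltn_neqAle ke andbT -jk eq_sym.
  by rewrite -val_eqE in ej; rewrite ej /= !mulr0.
rewrite (eq_bigl (fun e : I * 'I_m => true && (e.2 == j))) => [|e]; last first.
  by case: eqP => [->|]; rewrite ?andbF // -jk leqnn.
rewrite -(pair_big_dep xpredT (fun _ j' => j' == j)
   (fun i j' => a (i, j') * (G i c * f c ^+ (j' - k)))) /=.
by apply: eq_bigr => i' _; rewrite big_pred1_eq -jk subnn expr0 mulr1.
Qed.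

End Zariski.

End PolynomialFunctions.

(** * Nilpotency and triangular structures *)

Section Structures.
Local Open Scope ring_scope.
Variables (R : realType) (n : nat).
Local Notation C := (complex R).
Local Notation orbit := Defs.orbit.
Implicit Types (c d t : strc R n) (u v : 'rV[C]_n) (g : 'M[C]_n).

Definition rmulmx c v : 'M[C]_n := \matrix_(i, k) \sum_j v 0 j * c i j k.
Definition lmulmx c u : 'M[C]_n := \matrix_(j, k) \sum_i u 0 i * c i j k.

Lemma mulv_rmulmx c u v : mulv c u v = u *m rmulmx c v.
Proof.
apply/rowP => k; rewrite !mxE; apply: eq_bigr => i _; rewrite mxE mulr_sumr.
by apply: eq_bigr => j _; rewrite mulrA.
Qed.

Lemma mulv_lmulmx c u v : mulv c u v = v *m lmulmx c u.
Proof.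
apply/rowP => k; rewrite !mxE exchange_big; apply: eq_bigr => j _; rewrite mxE mulr_sumr.
by apply: eq_bigr => i _; rewrite mulrA [v 0 j * _]mulrC.
Qed.

Lemma mulvZl c a u v : mulv c (a *: u) v = a *: mulv c u v.
Proof. by rewrite !mulv_rmulmx scalemxAl. Qed.

Lemma mulvZr c a u v : mulv c u (a *: v) = a *: mulv c u v.
Proof. by rewrite !mulv_lmulmx scalemxAl. Qed.

Lemma mulvDl c u u' v : mulv c (u + u') v = mulv c u v + mulv c u' v.
Proof. by rewrite !mulv_rmulmx mulmxDl. Qed.

Lemma mulvDr c u v v' : mulv c u (v + v') = mulv c u v + mulv c u v'.
Proof. by rewrite !mulv_lmulmx mulmxDl. Qed.

Lemma mulv0 c u : mulv c u 0 = 0.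
Proof. by rewrite mulv_lmulmx mul0mx. Qed.

Lemma mul0v c u : mulv c 0 u = 0.
Proof. by rewrite mulv_rmulmx mul0mx. Qed.

Lemma mulv_sum2 c (I J : finType) (a : I -> C) (b : J -> C)
    (u : I -> 'rV[C]_n) (v : J -> 'rV[C]_n) :
  mulv c (\sum_i a i *: u i) (\sum_j b j *: v j) =
  \sum_i \sum_j (a i * b j) *: mulv c (u i) (v j).
Proof.
rewrite mulv_rmulmx mulmx_suml; apply: eq_bigr => i _.
rewrite -mulv_rmulmx mulv_lmulmx mulmx_suml; apply: eq_bigr => j _.
by rewrite -mulv_lmulmx mulvZl mulvZr scalerA.
Qed.

Lemma mulv_delta c i j : mulv c (delta_mx 0 i) (delta_mx 0 j) = \row_k c i j k.
Proof.
rewrite mulv_rmulmx -rowE; apply/rowP => k; rewrite !mxE (bigD1 j) //= big1 => [|l lj].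
  by rewrite mxE !eqxx mul1r addr0.
by rewrite mxE (negPf lj) andbF mul0r.
Qed.

Lemma mulv_mul_rows c m1 m2 (y : 'rV_m1) (z : 'rV_m2) (A : 'M_(m1, n)) (B : 'M_(m2, n)) :
  mulv c (y *m A) (z *m B) = \sum_i \sum_j (y 0 i * z 0 j) *: mulv c (row i A) (row j B).
Proof. by rewrite !mulmx_sum_row mulv_sum2. Qed.

Lemma eq_strc c d : (forall u v, mulv c u v = mulv d u v) -> c = d.
Proof.
move=> cd; apply: functional_extensionality => i; apply: functional_extensionality => j.
apply: functional_extensionality => k.
by have /rowP/(_ k) := cd (delta_mx 0 i) (delta_mx 0 j); rewrite !mulv_delta !mxE.
Qed.

(** With [B] the inverse of [A], these are the structure constants of [c] in the basis formed by the
    rows of [A]. *)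
Definition transport (A B : 'M[C]_n) c : strc R n :=
  fun i j k => (mulv c (row i A) (row j A) *m B) 0 k.

Lemma mulv_transport A B c u v :
  mulv (transport A B c) u v = mulv c (u *m A) (v *m A) *m B.
Proof.
rewrite mulv_mul_rows mulmx_suml; apply/rowP => k; rewrite mxE summxE.
apply: eq_bigr => i _; rewrite mulmx_suml summxE; apply: eq_bigr => j _.
by rewrite -scalemxAl mxE.
Qed.

(* For invertible [g] this is the change of basis by [g] up to the factor
   [\det g ^+ 2]; the adjugate replaces the inverse to keep it polynomial in [g]. *)
Definition act g c : strc R n := transport (\adj g) g c.

Lemma mulv_act g c u v : mulv (act g c) u v = mulv c (u *m \adj g) (v *m \adj g) *m g.
Proof. exact: mulv_transport. Qed.

Lemma orbit_transport g c : g \in unitmx -> orbit (transport g (invmx g) c) c.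
Proof. by move=> gU; exists g; split=> // u v; rewrite mulv_transport mulmxKV. Qed.

Definition scale_strc (a : C) c : strc R n := fun i j k => a * c i j k.

Lemma mulv_scale a c u v : mulv (scale_strc a c) u v = a *: mulv c u v.
Proof.
apply/rowP => k; rewrite !mxE mulr_sumr; apply: eq_bigr => i _; rewrite mulr_sumr.
by apply: eq_bigr => j _; rewrite /scale_strc; ring.
Qed.

Lemma orbit_act g c : g \in unitmx -> orbit (scale_strc (\det g ^+ 2) c) (act g c).
Proof.
move=> gU; exists g; split=> // u v.
rewrite mulv_act -!mulmxA mul_mx_adj !mul_mx_scalar.
by rewrite mulvZl mulvZr scalerA mulv_scale.
Qed.

Lemma orbit_act1 g c : \det g = 1 -> orbit c (act g c).
Proof.
move=> g1; have := @orbit_act g c; rewrite unitmxE g1 unitr1 expr1n.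
suff -> : scale_strc 1 c = c by apply.
by apply: eq_strc => u v; rewrite mulv_scale scale1r.
Qed.

(** Rescaling [c] compensates the determinant factor of [act]; triangular structures are stable
    under rescaling. *)
Lemma orbit_actE c d : orbit c d ->
  exists2 g, g \in unitmx & d = act g (scale_strc (\det g ^- 2) c).
Proof.
move=> [g [gU gE]]; exists g => //; apply: eq_strc => u v.
have dg : \det g != 0 by rewrite -unitfE -unitmxE.
rewrite mulv_act mulv_scale -scalemxAl -gE -!mulmxA mul_adj_mx !mul_mx_scalar.
rewrite mulvZl mulvZr !scalerA -[LHS]scale1r; congr (_ *: _).
by rewrite -mulrA -expr2 mulVf // expf_neq0.
Qed.

Lemma strc_orbit_trans c d e : orbit c d -> orbit d e -> orbit c e.
Proof.
move=> [g [gU gE]] [h [hU hE]]; exists (g *m h); split.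
  by rewrite unitmx_mul gU.
by move=> u v; rewrite !mulmxA hE gE.
Qed.

Definition triangular c := forall i j k : 'I_n, (k <= maxn i j)%N -> c i j k = 0.

Lemma triangular_scale a c : triangular c -> triangular (scale_strc a c).
Proof. by move=> tc i j k kij; rewrite /scale_strc tc ?mulr0. Qed.

(** The decreasing filtration of V by the spans of e_k, ..., e_(n-1), indices starting at 0. *)
Definition infilt k v := forall j : 'I_n, (j < k)%N -> v 0 j = 0.

Lemma infilt_le k l v : (k <= l)%N -> infilt l v -> infilt k v.
Proof. by move=> kl vl j jk; apply: vl; apply: leq_trans kl. Qed.

Lemma infilt_mulvl c k u v : triangular c -> infilt k u -> infilt k.+1 (mulv c u v).
Proof.
move=> tc uk j jk; rewrite mxE big1 // => i _; rewrite big1 // => l _.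
have [ik|ki] := ltnP i k; first by rewrite uk ?mul0r.
rewrite tc ?mulr0 //; move: ki jk; rewrite ltnS; lia.
Qed.

Lemma infilt_mulvr c k u v : triangular c -> infilt k v -> infilt k.+1 (mulv c u v).
Proof.
move=> tc uk j jk; rewrite mxE big1 // => i _; rewrite big1 // => l _.
have [ik|ki] := ltnP l k; first by rewrite uk ?mulr0 ?mul0r.
rewrite tc ?mulr0 //; move: ki jk; rewrite ltnS; lia.
Qed.

(* All words of length [k] in the left and right multiplications vanish at [v]. *)
Fixpoint kill c k v : Prop :=
  if k is k'.+1 then forall x, kill c k' (mulv c v x) /\ kill c k' (mulv c x v) else v = 0.

Lemma kill_lin c k a u v : kill c k u -> kill c k v -> kill c k (a *: u + v).
Proof.
elim: k u v => [|k IH] u v /=; first by move=> -> ->; rewrite scaler0 addr0.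
move=> ku kv x; have [u1 u2] := ku x; have [v1 v2] := kv x.
by rewrite mulvDl mulvDr mulvZl mulvZr; split; apply: IH.
Qed.

Lemma kill0 c k : kill c k 0.
Proof. by elim: k => //= k IH x; rewrite mulv0 mul0v. Qed.

Lemma kill_sum c k (I : finType) (a : I -> C) (u : I -> 'rV_n) :
  (forall i, kill c k (u i)) -> kill c k (\sum_i a i *: u i).
Proof.
move=> ku; elim: (index_enum I) => [|i r IH]; first by rewrite big_nil; apply: kill0.
by rewrite big_cons; apply: kill_lin.
Qed.

Lemma kill_submx c k m (A : 'M_(m, n)) v :
  (forall i, kill c k (row i A)) -> (v <= A)%MS -> kill c k v.
Proof. by move=> kA /submxP[y ->]; rewrite mulmx_sum_row; apply: kill_sum. Qed.

(** Each multiplication moves a vector one step down the filtration [infilt], whose n-th step is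
    0. *)
Lemma triangular_kill c v : triangular c -> kill c n v.
Proof.
move=> tc; suff H m u : infilt (n - m) u -> kill c m u by apply: H; rewrite subnn.
elim: m u => [|m IH] u um /=.
  by apply/rowP => j; rewrite mxE um ?subn0.
have le : (n - m <= (n - m.+1).+1)%N by lia.
by move=> x; split; apply: IH; apply: infilt_le le _;
  [apply: infilt_mulvl|apply: infilt_mulvr].
Qed.

Lemma orbit_kill c d k v g : g \in unitmx ->
  (forall u v, mulv d (u *m g) (v *m g) = mulv c u v *m g) ->
  kill c k v -> kill d k (v *m g).
Proof.
move=> gU gE; elim: k v => [|k IH] v /=; first by move=> ->; rewrite mul0mx.
move=> kv x; have [k1 k2] := kv (x *m invmx g).
have xE : x = x *m invmx g *m g by rewrite mulmxKV.
by rewrite xE !gE; split; apply: IH.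
Qed.

Lemma orbit_kill_all c d k : orbit c d -> (forall v, kill c k v) -> forall v, kill d k v.
Proof.
move=> [g [gU gE]] kc v; have -> : v = v *m invmx g *m g by rewrite mulmxKV.
exact: orbit_kill gE _.
Qed.

Lemma zclosed_kill k : zclosed (fun c => forall v, kill c k v).
Proof.
apply: zclosed_all => v.
(* The vector must be allowed to depend polynomially on [c], because the recursion replaces it by
   its products in [c]. *)
suff H (f : strc R n -> 'rV[C]_n) : (forall j, regular (fun c => f c 0 j)) ->
    zclosed (fun c => kill c k (f c)).
  by apply: (H (fun=> v)) => j; apply: (fa_const (funalg_regular R n)).
elim: k f => [|k IH] f rf /=.
  have [_ fwd] := zclosedP (fun c : strc R n => f c = 0); apply: fwd => c cf.
  apply/rowP => j; rewrite mxE; apply: (cf (fun c => f c 0 j)) => // d ->.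
  by rewrite mxE.
apply: zclosed_all => x.
have rx : forall j, regular (fun c : strc R n => x 0 j).
  by move=> j; apply: (fa_const (funalg_regular R n)).
have [_ fwd] := zclosedP (fun c => kill c k (mulv c (f c) x) /\ kill c k (mulv c x (f c))).
apply: fwd => c cf; split.
- have [+ _] := zclosedP (fun c => kill c k (mulv c (f c) x)); apply.
    by apply: IH => j; apply: fa_mulv => //; [exact: funalg_regular|exact: regular_coord].
  by move=> h rh h0; apply: cf => // d [? ?]; apply: h0.
- have [+ _] := zclosedP (fun c => kill c k (mulv c x (f c))); apply.
    by apply: IH => j; apply: fa_mulv => //; [exact: funalg_regular|exact: regular_coord].
  by move=> h rh h0; apply: cf => // d [? ?]; apply: h0.
Qed.

Lemma prodspP c (A B : 'M_n) u v : (u <= A)%MS -> (v <= B)%MS ->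
  (mulv c u v <= prodsp c A B)%MS.
Proof.
move=> /submxP[y ->] /submxP[z ->]; rewrite mulv_mul_rows.
apply: summx_sub => i _; apply: summx_sub => j _; apply: scalemx_sub.
rewrite /prodsp; apply: (sumsmx_sup i) => //; apply: (sumsmx_sup j) => //.
by rewrite genmxE.
Qed.

Lemma kill_sums c k (I : finType) (A : I -> 'M_n) v :
  (forall i u, (u <= A i)%MS -> kill c k u) -> (v <= \sum_i A i)%MS -> kill c k v.
Proof.
move=> kA /sub_sumsmxP[y ->].
rewrite (eq_bigr (fun i => 1 *: (y i *m A i))) => [|i _]; last by rewrite scale1r.
by apply: kill_sum => i; apply: (kA i); apply: submxMl.
Qed.

Lemma kill_prodsp c k (A B : 'M_n) v :
  (forall u w, (u <= A)%MS -> (w <= B)%MS -> kill c k (mulv c u w)) ->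
  (v <= prodsp c A B)%MS -> kill c k v.
Proof.
move=> kAB; apply: kill_sums => i u; apply: kill_sums => j w; rewrite genmxE => wE.
apply: kill_submx wE => l; rewrite row_id; apply: kAB; exact: row_sub.
Qed.

Lemma size_pows c k : size (pows c k) = k.+1.
Proof. by elim: k => //= k IH; rewrite size_rcons IH. Qed.

Lemma nth_pows c k i : (i <= k)%N -> nth 0 (pows c k) i = npow c i.+1.
Proof.
elim: k => [|k IH]; first by rewrite leqn0 => /eqP ->.
rewrite leq_eqVlt => /orP[/eqP -> //|ik].
by rewrite /= nth_rcons size_pows ik IH.
Qed.

Lemma npow1 c : npow c 1 = 1%:M.
Proof. by []. Qed.

Lemma npowS c m : npow c m.+2 = (\sum_(i < m.+1) prodsp c (npow c i.+1) (npow c (m - i).+1))%MS.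
Proof.
rewrite /npow /= nth_rcons size_pows ltnn eqxx; apply: eq_bigr => i _.
by rewrite !nth_pows // ?leq_subr // -ltnS.
Qed.

Lemma mulv_npow c k v x : (v <= npow c k.+1)%MS ->
  (mulv c v x <= npow c k.+2)%MS /\ (mulv c x v <= npow c k.+2)%MS.
Proof.
move=> vk; rewrite npowS; split.
- apply: (sumsmx_sup ord_max) => //=; apply: prodspP => //.
  by rewrite subnn npow1 submx1.
- apply: (sumsmx_sup ord0) => //=; apply: prodspP; first by rewrite npow1 submx1.
  by rewrite subn0.
Qed.

(** Multiplication on either side sends N^j into N^(j+1), so a word of length m ends in N^(m+1),
    which is 0. *)
Lemma nilpotent_kill c : nilpotent c -> exists m, forall v, kill c m v.
Proof.
move=> [[|m] [// _ /eqmxP Nm]]; exists m => v.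
suff H k u : (k <= m)%N -> (u <= npow c (m - k).+1)%MS -> kill c k u.
  by apply: H => //; rewrite subnn npow1 submx1.
elim: k u => [|k IH] u km uk /=.
  by move: uk; rewrite subn0 Nm submx0 => /eqP.
move=> x; have [] := mulv_npow x uk; have -> : (m - k.+1).+2 = (m - k).+1 by lia.
by move=> h1 h2; split; apply: IH; rewrite // ltnW.
Qed.

(** By induction on k, every N^l with l >= 2^k is killed by words of length m - k: a generating
    product of N^l with l >= 2^(k+1) has a factor in some N^a with a >= 2^k, and the other factor
    acts on it as one more multiplication. *)
Lemma kill_nilpotent c m : (forall v, kill c m v) -> nilpotent c.
Proof.
move=> km; exists (2 ^ m)%N; split; first by rewrite expn_gt0.
suff H k l v : (k <= m)%N -> (2 ^ k <= l)%N -> (v <= npow c l)%MS -> kill c (m - k) v.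
  apply/eqmxP; apply: eqmx_sym; apply/eqmxP; rewrite sub0mx; apply/row_subP => i.
  have := H m (2 ^ m)%N (row i (npow c (2 ^ m))) (leqnn _) (leqnn _) (row_sub _ _).
  by rewrite subnn /= => ->; apply: sub0mx.
elim: k l v => [|k IH] l v kltm; first by rewrite subn0.
have mk : (m - k = (m - k.+1).+1)%N by lia.
case: l => [|[|l]]; rewrite ?expnS; [lia|by have := expn_gt0 2 k; lia|] => kl.
rewrite npowS; apply: kill_sums => i u; apply: kill_prodsp => x y xA yB.
have [ki|ik] := leqP (2 ^ k) i.+1.
  by have := IH _ _ (ltnW kltm) ki xA; rewrite mk => /(_ y)[].
have kj : (2 ^ k <= (l - i).+1)%N by lia.
by have := IH _ _ (ltnW kltm) kj yB; rewrite mk => /(_ x)[].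
Qed.

(** Multiply [v] as long as some product stays outside [U]. This stops, since a word of length k
    gives 0, which lies in [U]; the last vector outside [U] is the required one. *)
Lemma kill_outside c k (U : 'M_n) v : kill c k v -> ~ (v <= U)%MS ->
  exists2 w, ~ (w <= U)%MS & forall x, (mulv c w x <= U)%MS /\ (mulv c x w <= U)%MS.
Proof.
elim: k v => [|k IH] v /=; first by move=> ->; rewrite sub0mx.
move=> kv vU; have [all|nall] := classic (forall x, (mulv c v x <= U)%MS /\ (mulv c x v <= U)%MS).
  by exists v.
have [x nx] := not_all_ex_not _ _ nall.
have [k1 k2] := kv x.
by have [h|h] := not_and_or _ _ nx; [apply: IH k1 h|apply: IH k2 h].
Qed.

(** The flag grows from its smallest term: [kill_outside] gives a vector outside the span of the
    rows already chosen, with all products inside it. It is put on top, so products with a row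
    involve only later rows. *)
Lemma kill_flag c m k : (forall v, kill c m v) -> (k <= n)%N ->
  exists2 B : 'M[C]_(k, n), row_free B &
  forall (i : 'I_k) x, exists y z : 'rV_k,
    [/\ mulv c (row i B) x = y *m B, mulv c x (row i B) = z *m B &
     forall j : 'I_k, (j <= i)%N -> y 0 j = 0 /\ z 0 j = 0].
Proof.
move=> km; elim: k => [|k IH] kn; first by exists 0; [rewrite /row_free mxrank0|case].
have [B Bfree BE] := IH (ltnW kn).
have [v vB] : exists v : 'rV[C]_n, ~ (v <= B)%MS.
  apply: NNPP => nex; have : row_full B.
    rewrite -sub1mx; apply/row_subP => i; apply: NNPP => ni; apply: nex.
    by exists (row i 1%:M).
  by rewrite /row_full (eqP Bfree) => /eqP kE; move: kn; rewrite kE ltnn.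
have BB u : (u <= <<B>>)%MS = (u <= B)%MS by rewrite genmxE.
have [w wB wE] : exists2 w : 'rV_n, ~ (w <= B)%MS &
    forall x, (mulv c w x <= B)%MS /\ (mulv c x w <= B)%MS.
  have [|w wB wE] := @kill_outside c m <<B>>%MS v (km v); first by rewrite BB.
  by exists w => [|x]; rewrite -!BB.
change (exists2 B : 'M[C]_(1 + k, n), row_free B &
  forall (i : 'I_(1 + k)) x, exists y z : 'rV_(1 + k),
    [/\ mulv c (row i B) x = y *m B, mulv c x (row i B) = z *m B &
     forall j : 'I_(1 + k), (j <= i)%N -> y 0 j = 0 /\ z 0 j = 0]).
exists (col_mx w B).
  have sB : (B <= w + B)%MS by apply: addsmxSr.
  have := mxrank_leqif_sup sB; rewrite addsmx_sub submx_refl andbT (introF idP wB).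
  case=> le neq; move: (rank_leq_row (col_mx w B)).
  rewrite /row_free -addsmxE; move: le neq; rewrite (eqP Bfree); lia.
have ext (y : 'rV_k) : y *m B = row_mx (0 : 'rV_1) y *m col_mx w B.
  by rewrite mul_row_col mul0mx add0r.
move=> i x; rewrite -(splitK i); case: (split i) => i' /=.
  rewrite rowKu row_id; have [/submxP[y yE] /submxP[z zE]] := wE x.
  exists (row_mx 0 y), (row_mx 0 z); rewrite -!ext; split=> // j.
  rewrite -(splitK j); case: (split j) => j' /=; first by rewrite !row_mxEl !mxE.
  by rewrite [i']ord1.
rewrite rowKd; have [y [z [yE zE y0]]] := BE i' x.
exists (row_mx 0 y), (row_mx 0 z); rewrite -!ext; split=> // j.
rewrite -(splitK j); case: (split j) => j' /=; first by rewrite !row_mxEl !mxE.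
by rewrite !row_mxEr !add1n ltnS => /y0.
Qed.

Lemma kill_orbit c m : (forall v, kill c m v) -> exists2 t, triangular t & orbit t c.
Proof.
move=> km; have [g gfree gE] := kill_flag km (leqnn n).
have gU : g \in unitmx by rewrite -row_free_unit.
exists (transport g (invmx g) c); last exact: orbit_transport.
move=> i j k; rewrite /transport leq_max => /orP[ki|kj].
  have [y [z [-> _ y0]]] := gE i (row j g); rewrite mulmxK //.
  by have [] := y0 k ki.
have [y [z [_ -> z0]]] := gE j (row i g); rewrite mulmxK //.
by have [] := z0 k kj.
Qed.

Lemma NilVP c : nilpotent c <-> exists2 t, triangular t & orbit t c.
Proof.
split=> [/nilpotent_kill[m /kill_orbit //]|[t tt tc]].
apply: (@kill_nilpotent _ n); apply: orbit_kill_all tc _ => v.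
exact: triangular_kill.
Qed.

(** The triangular form makes the length n of the killing words uniform over all nilpotent
    structures. *)
Lemma zclosed_NilV : zclosed (@NilV R n).
Proof.
have [_ fwd] := zclosedP (@NilV R n); apply: fwd => c cN.
apply: (@kill_nilpotent _ n).
have [+ _] := zclosedP (fun c => forall v, kill c n v); apply; first exact: zclosed_kill.
move=> f rf f0; apply: cN => // d /NilVP[t tt td]; apply: f0.
by apply: orbit_kill_all td _ => v; apply: triangular_kill.
Qed.

End Structures.

(** * Parametrization of the nilpotent structures *)

Section Parametrization.
Local Open Scope ring_scope.
Variables (R : realType) (n : nat).
Local Notation C := (complex R).
Local Notation orbit := Defs.orbit.
Implicit Types (c d t : strc R n) (u v : 'rV[C]_n) (g Y : 'M[C]_n).

Definition upper Y := forall i j : 'I_n, (j < i)%N -> Y i j = 0.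

Lemma det_upper Y : upper Y -> \det Y = \prod_i Y i i.
Proof.
move=> uY; rewrite -det_tr det_trig; first by apply: eq_bigr => i _; rewrite mxE.
by apply/is_trig_mxP => i j ij; rewrite mxE uY.
Qed.

Lemma upper_unit Y : upper Y -> (forall i, Y i i != 0) -> Y \in unitmx.
Proof.
by move=> uY Y0; rewrite unitmxE det_upper // unitfE; apply/prodf_neq0 => i _.
Qed.

Lemma upper_diag Y i : upper Y -> Y \in unitmx -> Y i i != 0.
Proof.
by move=> uY; rewrite unitmxE det_upper // unitfE => /prodf_neq0; apply.
Qed.

(** An upper triangular matrix preserves the filtration and acts on its graded pieces by the
    diagonal entries. *)
Lemma upper_coord Y k u (j : 'I_n) : upper Y -> infilt k u -> (j <= k)%N ->
  (u *m Y) 0 j = u 0 j * Y j j.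
Proof.
move=> uY ku jk; rewrite mxE (bigD1 j) //= big1 ?addr0 // => i ij.
have [/uY ->|ji] := ltnP j i; first by rewrite mulr0.
rewrite ku ?mul0r //; apply: leq_trans jk; rewrite ltn_neqAle ji andbT.
exact: ij.
Qed.

Lemma infilt_upper_inv Y k u : upper Y -> Y \in unitmx -> infilt k u ->
  infilt k (u *m invmx Y).
Proof.
move=> uY YU ku; suff H j : (j <= k)%N -> infilt j (u *m invmx Y) by apply: H.
elim: j => [//|j IH] jk i; rewrite ltnS leq_eqVlt => /orP[/eqP ij|ij]; last first.
  exact: IH (ltnW jk) _ ij.
have jj : infilt j (u *m invmx Y) := IH (ltnW jk).
have := upper_coord uY jj (eq_leq ij); rewrite mulmxKV // ku ?ij // => /esym/eqP.
by rewrite mulf_eq0 (negPf (upper_diag _ _ _)) // orbF => /eqP.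
Qed.

Lemma triangular_transport Y t : upper Y -> Y \in unitmx -> triangular t ->
  triangular (transport Y (invmx Y) t).
Proof.
move=> uY YU tt i j k; rewrite leq_max => kij.
have fr (l : 'I_n) : infilt l (row l Y) by move=> m ml; rewrite mxE uY.
case/orP: kij => kl; apply: (infilt_upper_inv uY YU) (leq_ltn_trans kl (ltnSn _)).
  exact: infilt_mulvl.
exact: infilt_mulvr.
Qed.

(** Coordinates of the parametrization: [inl (i, j, k)] is a structure constant, [inr (j, k)] the
    entry in row k and column j of the unitriangular matrix. [phi] depends on the coordinates
    satisfying [good], whose number is the dimension. *)
Definition param : finType := (coord3 n + 'I_n * 'I_n)%type.

Definition good (q : param) : bool :=
  match q with inl (i, j, k) => (maxn i j < k)%N | inr (j, k) => (j < k)%N end.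

Definition tri (x : param -> C) : strc R n :=
  fun i j k => if (maxn i j < k)%N then x (inl (i, j, k)) else 0.

Definition low (x : param -> C) : 'M[C]_n :=
  \matrix_(i, j) if (j < i)%N then x (inr (j, i)) else (i == j)%:R.

Definition phi (x : param -> C) : strc R n := act (low x) (tri x).

Lemma triangular_tri x : triangular (tri x).
Proof. by move=> i j k; rewrite /tri leqNgt => /negPf ->. Qed.

Lemma triP t : triangular t -> t = tri (fun q => if q is inl (i, j, k) then t i j k else 0).
Proof.
move=> tt; apply: functional_extensionality => i; apply: functional_extensionality => j.
apply: functional_extensionality => k; rewrite /tri; case: ltnP => // ?; exact: tt.
Qed.

Lemma det_low x : \det (low x) = 1.
Proof.
rewrite det_trig; last first.
  apply/is_trig_mxP => i j ij; rewrite mxE ltnNge ltnW //=.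
  by rewrite -val_eqE /= ltn_eqF.
by rewrite big1 // => i _; rewrite mxE ltnn eqxx.
Qed.

Lemma orbit_phi x : orbit (tri x) (phi x).
Proof. exact/orbit_act1/det_low. Qed.

Lemma phi_nilpotent x : nilpotent (phi x).
Proof. by apply/NilVP; exists (tri x); [apply: triangular_tri|apply: orbit_phi]. Qed.

Lemma phi_good x y : {in good, x =1 y} -> phi x = phi y.
Proof.
move=> xy; rewrite /phi; have -> : low x = low y.
  by apply/matrixP => i j; rewrite !mxE; case: ifP => // ji; apply: xy.
suff -> : tri x = tri y by [].
apply: functional_extensionality => i; apply: functional_extensionality => j.
by apply: functional_extensionality => k; rewrite /tri; case: ifP => // ji; apply: xy.
Qed.

Lemma fa_act X (P : (X -> C) -> Prop) (g : X -> 'M[C]_n) (t : X -> strc R n) i j k :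
  funalg P -> (forall i j, P (fun z => g z i j)) ->
  (forall i j k, P (fun z => t z i j k)) -> P (fun z => act (g z) (t z) i j k).
Proof.
move=> faP Pg Pt; apply: fa_mulmx => // i0 l; rewrite (ord1 i0).
apply: fa_mulv => // m.
  by apply: (fa_ext faP) (fa_adj faP _ m Pg) => z; rewrite [RHS]mxE.
by apply: (fa_ext faP) (fa_adj faP _ m Pg) => z; rewrite [RHS]mxE.
Qed.

Lemma fa_tri X (P : (X -> C) -> Prop) (x : X -> param -> C) i j k :
  funalg P -> (forall q, P (x^~ q)) -> P (fun z => tri (x z) i j k).
Proof.
move=> faP Px; rewrite /tri; case: (maxn i j < k)%N; first exact: Px.
exact: (fa_const faP).
Qed.

Lemma fa_phi X (P : (X -> C) -> Prop) (x : X -> param -> C) i j k :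
  funalg P -> (forall q, P (x^~ q)) -> P (fun z => phi (x z) i j k).
Proof.
move=> faP Px; apply: fa_act => // [{}i {}j|{}i {}j {}k]; last exact: fa_tri.
case: (boolP (j < i)%N) => ji.
  by apply: (fa_ext faP) (Px (inr (j, i))) => z; rewrite mxE ji.
by apply: (fa_ext faP) (fa_const faP (i == j)%:R) => z; rewrite mxE (negPf ji).
Qed.

(** The trailing principal block from k on, completed by identity entries to keep size n; its
    determinant is the trailing principal minor. *)
Definition corner g (k : nat) : 'M[C]_n :=
  \matrix_(i, j) if (k <= i)%N && (k <= j)%N then g i j else (i == j)%:R.

(* A Gauss factorization [g = Y^-1 u] with [u] lower unitriangular; it exists
   when all trailing principal minors of [g] are invertible. *)
Lemma gauss g : (forall k : 'I_n, corner g k \in unitmx) ->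
  exists2 Y, upper Y & exists x, Y *m g = low x.
Proof.
(* Row k of [Y *m g] must be e_k in the columns from k on. For a row of [Y] supported in these
   columns this is a linear system with matrix [corner g k], solved by row k of the inverse. *)
move=> cU; pose Y : 'M[C]_n := \matrix_k row k (invmx (corner g k)).
have YE k j : \sum_i Y k i * corner g k i j = (k == j)%:R.
  have /matrixP/(_ k j) := mulVmx (cU k); rewrite !mxE => <-.
  by apply: eq_bigr => i _; rewrite mxE mxE.
have uY : upper Y.
  move=> k j jk; have := YE k j; rewrite (bigD1 j) //= big1 => [|i ij].
    rewrite [corner _ _ _ _]mxE [(k <= j)%N]leqNgt jk andbF eqxx mulr1 addr0 => ->.
    by rewrite -val_eqE /= gtn_eqF.
  by rewrite [corner _ _ _ _]mxE [(k <= j)%N]leqNgt jk andbF (negPf ij) mulr0.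
exists Y => //; exists (fun q => if q is inr (j, i) then (Y *m g) i j else 0).
apply/matrixP => k j; rewrite [RHS]mxE; case: ltnP => // kj; rewrite -YE mxE.
apply: eq_bigr => i _; rewrite [corner _ _ _ _]mxE kj andbT.
by case: leqP => // ik; rewrite uY // !mul0r.
Qed.

(** In the Gauss factorization g = Y^-1 u, the upper triangular factor only turns [t] into another
    triangular structure, and u has the form [low y]. The scalar [\det g ^+ 2] comes from the
    adjugate in [act]. *)
Lemma act_phi g t : g \in unitmx -> triangular t ->
  (forall k : 'I_n, corner g k \in unitmx) -> exists x, act g t = phi x.
Proof.
move=> gU tt /gauss[Y uY [y Yg]].
have YU : Y \in unitmx.
  have := det_low y; rewrite -Yg det_mulmx => YG; rewrite unitmxE unitfE.
  by apply: contra_eq_neq YG => ->; rewrite mul0r eq_sym oner_neq0.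
pose t' := scale_strc (\det g ^+ 2) (transport Y (invmx Y) t).
have tt' : triangular t' by apply: triangular_scale; apply: triangular_transport.
exists (fun q => if q is inl (i, j, k) then t' i j k else y q).
rewrite /phi; have -> : low (fun q => if q is inl (i, j, k) then t' i j k else y q) = low y.
  by apply/matrixP => i j; rewrite !mxE.
have -> : tri (fun q => if q is inl (i, j, k) then t' i j k else y q) = t'.
  by rewrite [RHS](triP tt').
have lU : low y \in unitmx by rewrite unitmxE det_low unitr1.
apply: eq_strc => u v.
rewrite -[u](mulmxKV lU) -[v](mulmxKV lU); move: (u *m _) (v *m _) => {}u {}v.
have lK (w : 'rV_n) : w *m low y *m \adj (low y) = w.
  by rewrite -mulmxA mul_mx_adj det_low mulmx1.
have lg (w : 'rV_n) : w *m low y *m \adj g = \det g *: (w *m Y).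
  by rewrite -Yg -!mulmxA mul_mx_adj !mul_mx_scalar scalemxAr.
rewrite !mulv_act !lK !lg mulv_scale mulv_transport mulvZl mulvZr scalerA.
by rewrite -!scalemxAl -Yg mulmxA mulmxKV // expr2.
Qed.

(** On the line from the identity to [g], the Gauss factorization exists outside the zeros of the
    polynomial [q], which is 1 at the identity. There [f] vanishes by [act_phi], hence also at
    [g]. *)
Lemma phi_dense f : regular f -> (forall x, f (phi x) = 0) ->
  forall c, nilpotent c -> f c = 0.
Proof.
move=> rf f0 c /NilVP[t tt /orbit_actE[g gU ->]].
set t' := scale_strc _ t; have tt' : triangular t' by apply: triangular_scale.
pose gs s : 'M[C]_n := \matrix_(i, j) ((1 - s) * (i == j)%:R + s * g i j).
have pgs i j : polyfun (fun s => gs s i j).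
  by apply: (fa_ext (funalg_polyfun R)) (polyfun_line (i == j)%:R (g i j)) => s; rewrite mxE.
have g1 : gs 1 = g.
  by apply/matrixP => i j; rewrite mxE subrr mul0r add0r mul1r.
have g0 : gs 0 = 1%:M.
  by apply/matrixP => i j; rewrite !mxE subr0 mul0r addr0 mul1r.
have corner1 k : corner 1%:M k = 1%:M.
  by apply/matrixP => i j; rewrite !mxE; case: ifP.
pose q s := \det (gs s) * \prod_(k < n) \det (corner (gs s) k).
have pq : polyfun q.
  apply: (fa_mul (funalg_polyfun R)); first by apply: (fa_det (funalg_polyfun R) (A := gs)).
  apply: fa_prod => [|k]; first exact: funalg_polyfun.
  apply: (fa_det (funalg_polyfun R) (A := fun s => corner (gs s) k)) => i j.
  case: (boolP ((k <= i)%N && (k <= j)%N)) => kij.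
    by apply: (fa_ext (funalg_polyfun R)) (pgs i j) => s; rewrite [RHS]mxE kij.
  apply: (fa_ext (funalg_polyfun R)) (fa_const (funalg_polyfun R) (i == j)%:R) => s.
  by rewrite mxE (negPf kij).
rewrite -g1; apply: (polyfun_dense (f := fun s => f (act (gs s) t')) (s0 := 0) _ pq).
- apply: fa_regular rf; first exact: funalg_polyfun.
  move=> i j k; apply: fa_act => //; first exact: funalg_polyfun.
  by move=> *; apply: (fa_const (funalg_polyfun R)).
- rewrite /q g0 det1 mul1r big1 ?oner_neq0 // => k _; by rewrite corner1 det1.
move=> s; rewrite mulf_eq0 negb_or => /andP[gsU /prodf_neq0 cU].
have [||x ->] := @act_phi (gs s) t' _ tt'; rewrite ?f0 ?unitmxE ?unitfE // => k.
by rewrite unitmxE unitfE cU.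
Qed.

Lemma polyfun_segment (x y : param -> C) i j k :
  polyfun (fun s => phi (fun q => (1 - s) * x q + s * y q) i j k).
Proof. by apply: fa_phi (funalg_polyfun R) _ => q; apply: polyfun_line. Qed.

(** Segments in a coordinate subspace of parameters map to polynomial curves. [Q] marks the
    parameters allowed to be nonzero: all of them for Nil_n, an initial part for the members of the
    chain bounding the dimension from below. *)
Lemma zirreducible_phi (Q : pred param) :
  zirreducible (zclosure (fun c => exists2 x, (forall q, ~~ Q q -> x q = 0) & c = phi x)).
Proof.
apply: zirreducible_closure; first by exists (phi (fun=> 0)); exists (fun=> 0).
move=> _ _ [x x0 ->] [y y0 ->].
exists (fun s => phi (fun q => (1 - s) * x q + s * y q)); split.
- exact: polyfun_segment.
- move=> s; exists (fun q => (1 - s) * x q + s * y q) => // q nQ.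
  by rewrite x0 // y0 // !mulr0 addr0.
- by congr phi; apply: functional_extensionality => q; rewrite subr0 mul1r mul0r addr0.
- by congr phi; apply: functional_extensionality => q; rewrite subrr mul1r mul0r add0r.
Qed.

Lemma zclosure_phi : @NilV R n =
  zclosure (fun c => exists2 x, (forall q, ~~ predT q -> x q = 0) & c = phi x).
Proof.
apply: functional_extensionality => c; apply: propositional_extensionality; split.
  move=> cN; apply/zclosureP => f rf f0; apply: phi_dense cN => // x.
  by apply: f0; exists x.
by apply: zclosure_min c; [apply: zclosed_NilV|move=> _ [x _ ->]; apply: phi_nilpotent].
Qed.

End Parametrization.

(** * Genericity *)

Section Generic.
Local Open Scope ring_scope.
Variables (R : realType).
Local Notation C := (complex R).
Local Notation orbit := Defs.orbit.

Section Coordinates.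
Variables (n : nat) (t : strc R n) (tt : triangular t).
Implicit Types (u v : 'rV[C]_n).

(** The coordinates of [v] before i vanish, and those after i contribute only beyond k because [t]
    is triangular. *)
Lemma mulv_coordr (i k : 'I_n) u v : infilt i v -> (k <= i.+1)%N ->
  mulv t u v 0 k = v 0 i * \sum_j u 0 j * t j i k.
Proof.
move=> vi ki; rewrite mxE mulr_sumr; apply: eq_bigr => j _.
rewrite (bigD1 i) //= big1 ?addr0 => [|l li]; first by rewrite mulrA [v 0 i * _]mulrC.
have [il|/vi ->] := leqP i l; last by rewrite mulr0 mul0r.
rewrite tt ?mulr0 // leq_max; apply/orP; right; apply: leq_trans ki _.
by rewrite ltn_neqAle il andbT eq_sym.
Qed.

Lemma mulv_coordl (i k : 'I_n) u v : infilt i u -> (k <= i.+1)%N ->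
  mulv t u v 0 k = u 0 i * \sum_j v 0 j * t i j k.
Proof.
move=> ui ki; rewrite mxE (bigD1 i) //= [X in _ + X]big1 ?addr0 => [|l li].
  by rewrite mulr_sumr; apply: eq_bigr => j _; rewrite mulrA.
rewrite big1 // => j _; have [il|/ui ->] := leqP i l; last by rewrite !mul0r.
rewrite tt ?mulr0 // leq_max; apply/orP; left; apply: leq_trans ki _.
by rewrite ltn_neqAle il andbT eq_sym.
Qed.

Lemma infilt_square (x : 'rV[C]_n) i : infilt i (iter i (fun u => mulv t u u) x).
Proof. by elim: i => [|i IH] //=; apply: infilt_mulvl. Qed.

End Coordinates.

(* [x] is chosen so that [x y] has no [e_{i+1}]-component for [y] in the [i]-th
   step of the filtration; its successive squares then form the wanted basis. *)
Lemma Rfam_orbit n (t : strc R n) : (3 <= n)%N -> triangular t ->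
  (forall i k : 'I_n, k = i.+1 :> nat -> t i i k != 0) ->
  (forall i j k : 'I_n, i = 1%N :> nat -> j = 0%N :> nat -> k = 2%N :> nat ->
    t i j k != t j i k) ->
  exists2 a, Rfam a & orbit a t.
Proof.
case: n t => [|[|[|m]]] // t _ tt tdiag t10.
pose o k : 'I_m.+3 := inord k.
have oE k : (k < m.+3)%N -> o k = k :> nat by move=> ?; rewrite /o inordK.
(* With indices from 0, column i gives the e_(i+1)-coefficient of x e_i; the first and last columns
   are unit columns completing an upper triangular matrix. *)
pose M : 'M[C]_m.+3 := \matrix_(j, i)
  if (0 < i)%N && (i.+1 < m.+3)%N then t j i (o i.+1) else (j == i)%:R.
have uM : upper M.
  move=> j i ij; rewrite mxE; case: ifP => [/andP[_ im]|_].
    by rewrite tt // leq_max oE // ij.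
  by rewrite -val_eqE /= gtn_eqF.
have MU : M \in unitmx.
  apply: upper_unit => // i; rewrite mxE; case: ifP => [/andP[_ im]|_].
    by rewrite tdiag // oE.
  by rewrite eqxx oner_neq0.
(* Equality of the e_2-coordinates of b_1 b_0 and b_2 reads [x0 ^+ 3 * t 0 0 1 * (t 1 0 2 - t 0 1 2)
   = x0 ^+ 4 * t 0 0 1 ^+ 2 * t 1 1 2]; this is its nonzero solution. *)
pose x0 := (t (o 1) (o 0) (o 2) - t (o 0) (o 1) (o 2)) /
           (t (o 0) (o 0) (o 1) * t (o 1) (o 1) (o 2)).
have x0n : x0 != 0.
  rewrite mulf_neq0 ?invr_neq0 ?mulf_neq0 ?tdiag ?oE //.
  by rewrite subr_eq0 t10 ?oE.
have [x xM] : exists x : 'rV[C]_m.+3, forall i,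
    \sum_j x 0 j * M j i = x0 * (i == o 0)%:R.
  exists (x0 *: delta_mx 0 (o 0) *m invmx M) => i.
  transitivity ((x0 *: delta_mx (0 : 'I_1) (o 0) *m invmx M *m M) 0 i); first by rewrite [RHS]mxE.
  by rewrite mulmxKV // !mxE.
have xsum (i : 'I_m.+3) : (0 < i)%N -> (i.+1 < m.+3)%N ->
    \sum_j x 0 j * t j i (o i.+1) = 0.
  move=> i0 im; transitivity (\sum_j x 0 j * M j i).
    by apply: eq_bigr => j _; rewrite mxE i0 im.
  by rewrite xM -val_eqE /= oE // gtn_eqF ?mulr0.
have x00 : x 0 (o 0) = x0.
  have := xM (o 0); rewrite eqxx mulr1 => <-.
  rewrite (bigD1 (o 0)) //= big1 ?addr0 => [|j j0]; rewrite mxE oE // ?eqxx ?mulr1 //.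
  by rewrite (negPf j0) mulr0.
pose b k := iter k (fun u => mulv t u u) x.
have bf k : infilt k (b k) by apply: infilt_square.
have bS (i k : 'I_m.+3) : k = i.+1 :> nat -> b i.+1 0 k = b i 0 i ^+ 2 * t i i k.
  move=> ki; rewrite /b /= -/(b i) (mulv_coordl tt _ (bf i)) ?ki //.
  rewrite (bigD1 i) //= big1 ?addr0 => [|j ji]; first by rewrite mulrA.
  have [ij|/bf ->] := leqP i j; last by rewrite mul0r.
  rewrite tt ?mulr0 // ki leq_max; apply/orP; right.
  by rewrite ltn_neqAle ij andbT eq_sym.
have bn k (i : 'I_m.+3) : i = k :> nat -> b k 0 i != 0.
  elim: k i => [|k IH] i ik; last first.
    have ks : (k < m.+3)%N by rewrite ltnW // -ik.
    have kE := oE _ ks; rewrite -[k in b k.+1]kE bS ?ik ?kE //.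
    by rewrite mulf_neq0 ?expf_neq0 ?IH ?tdiag // kE ik.
  have -> : i = o 0 by apply: val_inj; rewrite /= ik oE.
  by rewrite -x00 in x0n.
pose g : 'M[C]_m.+3 := \matrix_i b i.
have rg i : row i g = b i by rewrite rowK.
have ug : upper g by move=> i j ij; rewrite mxE bf.
have gU : g \in unitmx by apply: upper_unit => // i; rewrite mxE bn.
(* Leading coordinates in the basis [g] and in the standard basis differ by a diagonal entry of [g],
   so the conditions on leading coefficients can be tested in the standard basis. *)
have gc (z : 'rV[C]_m.+3) (k : 'I_m.+3) : infilt k z -> z 0 k = (z *m invmx g) 0 k * g k k.
  move=> zk; rewrite -(upper_coord ug (infilt_upper_inv ug gU zk)) // mulmxKV //.
have bg (i : 'I_m.+3) : b i *m invmx g = delta_mx 0 i.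
  by rewrite -rg -row_mul mulmxV // row1.
exists (transport g (invmx g) t); last exact: orbit_transport.
split.
- exact: triangular_transport.
- move=> i k im; rewrite /transport rg -[mulv _ _ _]/(b i.+1).
  have -> : i.+1 = o i.+1 by rewrite oE.
  by rewrite bg mxE eqxx.
- move=> i j k i1 j0 k2; rewrite /transport !rg i1 j0.
  have kE : k = o 2 by apply: val_inj; rewrite /= k2 oE.
  have z2 : infilt k (mulv t (b 1%N) (b 0%N)).
    by rewrite k2; apply: infilt_mulvl => //; apply: bf.
  have gkk : g k k != 0 by rewrite mxE bn.
  apply: (mulIf gkk); rewrite -gc // mul1r [g k k]mxE k2.
  have o1 := oE 1%N isT; have o0 := oE 0%N isT.
  have f1 : infilt (o 1%N) (b 1%N) by rewrite o1.
  rewrite (mulv_coordl tt _ f1) ?k2 ?o1 //.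
  have := bS (o 1%N) k; rewrite o1 => -> //.
  have := bS (o 0%N) (o 1%N); rewrite o0 => -> //.
  rewrite expr2 -!mulrA; congr (_ * _).
  (* Subtracting the relation [xsum] at index 1 leaves the term j = 0: the term j = 1 cancels and
     those with j >= 2 vanish by triangularity. *)
  have -> : \sum_j x 0 j * t (o 1) j k = x0 * (t (o 1) (o 0) k - t (o 0) (o 1) k).
    rewrite -[LHS]subr0 -[X in _ - X](xsum (o 1%N)) ?o1 // -kE -sumrB.
    rewrite (bigD1 (o 0)) //= big1 ?addr0 => [|j' j'0]; first by rewrite x00 mulrBr.
    have [->|j'1] := eqVneq j' (o 1%N); first by rewrite subrr.
    have j2 : (2 <= j')%N.
      by move: j'0 j'1; rewrite -!val_eqE /= o0 o1; case: (nat_of_ord j') => [|[]].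
    by rewrite !tt ?mulr0 ?subrr // k2 leq_max j2 ?orbT.
  have d1 := tdiag (o 0) (o 1); have d2 := tdiag (o 1) (o 2).
  rewrite [b 0%N 0 _]x00 kE /x0; field.
  by rewrite d1 ?d2 ?oE.
- move=> h i k h0 i1 im ki; rewrite /transport !rg h0.
  have kE : k = o i.+1 by apply: val_inj; rewrite /= ki oE.
  have zk : infilt k (mulv t (b 0%N) (b i)) by rewrite ki; apply: infilt_mulvr.
  have gkk : g k k != 0 by rewrite mxE bn.
  apply: (mulIf gkk); rewrite -gc // mul0r (mulv_coordr tt _ (bf i)) ?ki //.
  by rewrite kE xsum ?mulr0.
Qed.

Lemma triangular_Rfam n (a : strc R n) : Rfam a -> triangular a.
Proof. by case. Qed.

Lemma generic_Rfam n : (3 <= n)%N -> generic (@Rfam R n) (@NilV R n).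
Proof.
case: n => [|[|[|m]]] // _ c; split.
  apply: zclosure_min c; first exact: zclosed_NilV.
  by move=> d [a [/triangular_Rfam ta ad]]; apply/NilVP; exists a.
move=> cN; apply/zclosureP => f rf f0; apply: phi_dense cN => // x.
(* A base point satisfying the open conditions of [Rfam_orbit]: its nonzero products are e_i^2 =
   e_(i+1) and e_1 e_0 = e_2. The line [y] joins it to [x]. *)
pose x1 (q : param m.+3) : C := match q with
  | inl (i, j, k) => ((i == j) && (k == i.+1 :> nat) ||
       [&& i == 1%N :> nat, j == 0%N :> nat & k == 2%N :> nat])%:R
  | inr _ => 0 end.
pose y s q := (1 - s) * x1 q + s * x q.
have faP := funalg_polyfun R.
have ptri i j k : polyfun (fun s => tri (y s) i j k).
  by apply: fa_tri => // q; apply: polyfun_line.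
pose o k : 'I_m.+3 := inord k.
have oE k : (k < m.+3)%N -> o k = k :> nat by move=> ?; rewrite /o inordK.
(* [q s] is nonzero exactly when [tri (y s)] satisfies the two inequality hypotheses of
   [Rfam_orbit]. *)
pose q s := (\prod_(p : 'I_m.+3 * 'I_m.+3 | p.2 == p.1.+1 :> nat) tri (y s) p.1 p.1 p.2) *
  (tri (y s) (o 1) (o 0) (o 2) + (-1) * tri (y s) (o 0) (o 1) (o 2)).
have pq : polyfun q.
  apply: (fa_mul faP); first by apply: fa_prod.
  apply: (fa_add faP) => //; apply: (fa_mul faP) => //; exact: (fa_const faP).
have -> : phi x = phi (y 1).
  by congr phi; apply: functional_extensionality => p; rewrite /y subrr mul0r add0r mul1r.
apply: (polyfun_dense (f := fun s => f (phi (y s))) (s0 := 0) _ pq).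
- apply: fa_regular rf => // i j k; apply: fa_phi => // p; exact: polyfun_line.
- have y0 : y 0 = x1.
    by apply: functional_extensionality => p; rewrite /y subr0 mul1r mul0r addr0.
  rewrite /q y0 mulf_neq0 //.
    apply/prodf_neq0 => -[i k] /= /eqP ki.
    by rewrite /tri maxnn ki ltnSn /= ki !eqxx oner_neq0.
  rewrite /tri /= !oE //= -!val_eqE /= !oE //= mulr0 addr0 oner_neq0 //.
move=> s; rewrite mulf_eq0 negb_or => /andP[/prodf_neq0 q1 q2].
apply: f0; have [|i k ki|i j k i1 j0 k2|a Ra a_t] := @Rfam_orbit _ (tri (y s)) isT.
- exact: triangular_tri.
- by apply: (q1 (i, k)); rewrite /= ki.
- have -> : i = o 1%N by apply: val_inj; rewrite /= oE.
  have -> : j = o 0%N by apply: val_inj; rewrite /= oE.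
  have -> : k = o 2%N by apply: val_inj; rewrite /= oE.
  by move: q2; rewrite mulN1r subr_eq0.
by exists a; split=> //; apply: strc_orbit_trans a_t (orbit_phi _).
Qed.

End Generic.

(** * Dimension *)

Section Dimension.
Local Open Scope ring_scope.
Variables (R : realType) (n : nat).
Local Notation C := (complex R).
Local Notation orbit := Defs.orbit.
Local Notation D := #|@good n|.

Lemma card_good : D = ((n * (n - 1) * (n + 1)) %/ 3)%N.
Proof.
have lt (k : 'I_n) : (\sum_(i < n | (i < k)%N) 1 = k)%N.
  by rewrite (big_ord_narrow (ltnW (ltn_ord k))) sum1_card card_ord.
(* With indices from 0, the top index k carries k^2 structure constants (i, j < k) and k matrix
   entries (j < k). *)
have -> : D = (\sum_(k < n) k * k.+1)%N.
  rewrite -sum1_card big_sumType /=.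
  rewrite (eq_bigr (fun k : 'I_n => k * k + k)%N) => [|k _]; last by rewrite mulnS addnC.
  rewrite big_split /=; congr (_ + _)%N.
    transitivity (\sum_(p : 'I_n * 'I_n) \sum_(k < n | (maxn p.1 p.2 < k)%N) 1)%N.
      by rewrite pair_big_dep /=; apply: eq_bigl => -[[i j] k].
    rewrite (exchange_big_dep xpredT) //=; apply: eq_bigr => k _.
    rewrite -[in RHS](lt k) big_distrlr /= pair_big /=.
    by apply: eq_bigl => -[i j] /=; rewrite gtn_max.
  transitivity (\sum_(k < n) \sum_(j < n | (j < k)%N) 1)%N; last first.
    by apply: eq_bigr => k _.
  rewrite (exchange_big_dep xpredT) //= pair_big_dep /=.
  by apply: eq_bigl => -[j k].
suff H : (3 * (\sum_(k < n) k * k.+1) = n * (n - 1) * (n + 1))%N by rewrite -H mulKn.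
elim: n => [|m IH]; first by rewrite big_ord0.
rewrite big_ord_recr /= mulnDr IH; case: m {IH} => // m; nia.
Qed.

Lemma act1 (t : strc R n) : act 1%:M t = t.
Proof.
have adj1 : \adj (1%:M : 'M[C]_n) = 1%:M by rewrite -[LHS]mul1mx mul_mx_adj det1.
by apply: eq_strc => u v; rewrite mulv_act adj1 !mulmx1.
Qed.

Lemma mulv_phi x (u v : 'rV[C]_n) :
  mulv (phi x) (u *m low x) (v *m low x) = mulv (tri x) u v *m low x.
Proof.
have lK (w : 'rV_n) : w *m low x *m \adj (low x) = w.
  by rewrite -mulmxA mul_mx_adj det_low mulmx1.
by rewrite mulv_act !lK.
Qed.

(** The order in which parameters are switched on: structure constants first, then the entries of
    [low x], row by row. *)
Definition rank_param (q : param n) : nat := if q is inr (j, k) then k else 0.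

Lemma phi_rank0 x : (forall q, (0 < rank_param q)%N -> x q = 0) -> phi x = tri x :> strc R n.
Proof.
move=> x0; rewrite /phi; suff -> : low x = 1%:M by rewrite act1.
apply/matrixP => i j; rewrite !mxE; case: ltnP => // ji.
rewrite x0 /= ?(leq_ltn_trans _ ji) // -val_eqE /= gtn_eqF //.
Qed.

(** * Regular functions detecting one entry of the unitriangular matrix *)

Section Separation.
Variables (j k : 'I_n) (jk : (j < k)%N).

Let n_gt0 : (0 < n)%N. Proof. exact: leq_ltn_trans (ltn_ord j). Qed.
Let e0 : 'rV[C]_n := delta_mx 0 (Ordinal n_gt0).
(** The left-normed power of e_0 with i + 1 factors. *)
Let w i (c : strc R n) := iter i (fun u => mulv c u e0) e0.

Let regular_w i l : regular (fun c => w i c 0 l).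
Proof.
elim: i l => [|i IH] l; first exact: (fa_const (funalg_regular R n)).
apply: fa_mulv => //; [exact: funalg_regular|exact: regular_coord|].
by move=> m; apply: (fa_const (funalg_regular R n)).
Qed.

Let infilt_w i x : infilt i (w i (phi x) *m \adj (low x)).
Proof.
elim: i => [//|i IH]; rewrite /w /= -/(w i _) mulv_act -mulmxA mul_mx_adj.
by rewrite det_low mulmx1; apply: infilt_mulvl => //; apply: triangular_tri.
Qed.

(** [w k (phi x)] is a combination of the rows i >= k of [low x]. When [inr (j, k)] and all
    parameters of larger rank vanish, these rows are 0 in column j, so the j-th coordinate of the
    power vanishes. *)
Lemma separate_low : exists f : strc R n -> C, [/\ regular f,
  forall x, (forall q, (q == inr (j, k)) || (k < rank_param q)%N -> x q = 0) ->
    f (phi x) = 0 &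
  exists x, (forall q, x q != 0 ->
      (q == inr (j, k)) || good q && (rank_param q < k)%N) /\ f (phi x) <> 0].
Proof.
exists (fun c => w k c 0 j); split; first exact: regular_w.
  move=> x x0; pose y := w k (phi x) *m \adj (low x).
  have -> : w k (phi x) = y *m low x.
    by rewrite -mulmxA mul_adj_mx det_low mulmx1.
  rewrite mxE big1 // => i _; have [ik|ki] := ltnP i k.
    by rewrite [y 0 i]infilt_w ?mul0r.
  rewrite [low x i j]mxE (leq_trans jk ki) x0 ?mulr0 // /rank_param.
  case: (ltngtP k i) ki => // ki _; first by rewrite orbT.
  by rewrite (val_inj ki) eqxx.
(* Here e_a e_0 = e_(a+1) in [tri x], and the only off-diagonal entry of [low x] is a 1 in row k,
   column j. The power is then row k of [low x], with j-th coordinate 1. *)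
pose x (q : param n) : C := match q with
  | inl (a, b, c) => ((b == 0%N :> nat) && (c == a.+1 :> nat))%:R
  | inr p => (p == (j, k))%:R end.
exists x; split.
  case=> [[[a b] c]|p] /=; rewrite pnatr_eq0 eqb0 negbK.
    case/andP=> /eqP b0 /eqP ca; rewrite b0 maxn0 ca ltnSn /=.
    exact: leq_ltn_trans jk.
  by move=> /eqP ->; rewrite eqxx.
have e0E : e0 = e0 *m low x.
  rewrite /e0 -rowE; apply/rowP => l; rewrite !mxE /= eq_sym.
  by rewrite ?eqxx.
suff H i (a : 'I_n) : a = i :> nat -> w i (phi x) = delta_mx 0 a *m low x.
  by rewrite (H k k) // -rowE !mxE jk /x eqxx; apply/eqP/oner_neq0.
elim: i a => [|i IH] a ai.
  by rewrite /w /= {1}e0E; congr (delta_mx _ _ *m _); apply: val_inj.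
have lti : (i < n)%N by rewrite ltnW // -ai.
rewrite /w /= -/(w i _) (IH (Ordinal lti)) // [in LHS]e0E mulv_phi mulv_delta.
congr (_ *m _); apply/rowP => l; rewrite !mxE /tri /= maxn0 -val_eqE /= ai.
case: ltnP => // il; rewrite ltn_eqF //.
Qed.

End Separation.

Lemma separate (p : param n) : good p -> exists f : strc R n -> C, [/\ regular f,
  forall x, (forall q, (q == p) || (rank_param p < rank_param q)%N -> x q = 0) ->
    f (phi x) = 0 &
  exists x, (forall q, x q != 0 ->
      (q == p) || good q && (rank_param q < rank_param p)%N) /\ f (phi x) <> 0].
Proof.
case: p => [[[i j] k]|[j k]] /= gp; last exact: separate_low.
(* A structure constant has rank 0: all matrix entries are still 0, so [phi x] is [tri x] and its
   coordinate detects the parameter. *)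
exists (fun c => c i j k); split; first exact: regular_coord.
  move=> x x0; rewrite phi_rank0 => [|q q0]; last by rewrite x0 // q0 orbT.
  by rewrite /tri x0 ?eqxx ?if_same.
exists (fun q => (q == inl (i, j, k))%:R); split=> [q|].
  by rewrite pnatr_eq0 eqb0 negbK => ->.
rewrite phi_rank0 => [|q q0]; first by rewrite /tri gp eqxx; apply/eqP/oner_neq0.
by case: eqP q0 => // ->.
Qed.

(** [A m] is the image of the subspace of the first m good parameters, sorted by rank. The function
    that [separate] gives for the next parameter vanishes on [A m] but not on [A m.+1], so the
    closures increase strictly. *)
Lemma irr_chain_NilV : irr_chain (@NilV R n) D.
Proof.
pose s := sort (relpre rank_param leq) (enum (@good n)).
have sz : size s = D by rewrite size_sort -cardE.
have us : uniq s by rewrite sort_uniq enum_uniq.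
have ms q : (q \in s) = good q by rewrite mem_sort mem_enum.
have srt q1 q2 : q1 \in s -> q2 \in s -> (index q1 s <= index q2 s)%N ->
    (rank_param q1 <= rank_param q2)%N.
  move=> q1s q2s le12.
  have tr : transitive (relpre rank_param leq) by move=> ? ? ? /=; apply: leq_trans.
  have refl : reflexive (relpre rank_param leq) by move=> ? /=.
  have sorted_s : sorted (relpre rank_param leq) s.
    by apply: sort_sorted => ? ? /=; apply: leq_total.
  have := sorted_leq_nth tr refl q1 sorted_s (index q1 s) (index q2 s).
  by rewrite !inE !index_mem !nth_index //=; apply.
pose A m (c : strc R n) := exists2 x : param n -> C,
  (forall q, ~~ (q \in take m s) -> x q = 0) & c = phi x.
exists (fun m => zclosure (A m)); split=> m md.
  split; [exact: zclosed_zclosure|exact: zirreducible_phi|].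
  by apply: zclosure_min; [apply: zclosed_NilV|move=> _ [x _ ->]; apply: phi_nilpotent].
have sub : ssubset (A m) (A m.+1).
  move=> _ [x x0 ->]; exists x => // q; case: (boolP (q \in s)) => qs.
    by rewrite in_take // -leqNgt => /ltnW mq; rewrite x0 // in_take // -leqNgt.
  by move=> _; apply: x0; apply: contra qs; apply: mem_take.
split.
  by apply: zclosure_min; [apply: zclosed_zclosure|move=> c /sub; apply: subset_zclosure].
have [p0 _] : exists p0 : param n, true.
  by case: s sz {us ms srt A sub} md => [<-//|p0 *]; exists p0.
pose p := nth p0 s m; have ps : p \in s by rewrite mem_nth ?sz.
have ip : index p s = m by rewrite index_uniq ?sz.
have [f [rf f0 [x [x0 fx]]]] := separate (etrans (esym (ms p)) ps).
move=> Zsub; apply: fx; have /zclosureP : zclosure (A m) (phi x).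
  apply: Zsub; apply: subset_zclosure; exists x => // q.
  apply: contraNeq => /x0 /orP[/eqP ->|/andP[gq qp]]; first by rewrite in_take // ip.
  rewrite -ms in gq; rewrite in_take // ltnS leqNgt; apply: contraL qp => mq.
  by rewrite -leqNgt srt // ip ltnW.
apply=> // _ [y y0 ->]; apply: f0 => q /orP[/eqP ->|qp]; apply: y0.
  by rewrite in_take // ip ltnn.
apply: contraL qp => qm; have qs := mem_take qm; rewrite in_take // in qm.
by rewrite -leqNgt srt // ip ltnW.
Qed.

(** Extension by zero of the D good coordinates, written as a sum so that [fa_sum] gives its
    polynomiality. *)
Definition emb (y : 'I_D -> C) (q : param n) : C := \sum_(i < D | enum_val i == q) y i.

Lemma phi_emb x : exists y, phi x = phi (emb y) :> strc R n.
Proof.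
exists (fun i => x (enum_val i)); apply: phi_good => q gq.
rewrite /emb (big_pred1 (enum_rank_in gq q)) ?enum_rankK_in // => i.
apply/eqP/eqP => [iq|->]; last by rewrite enum_rankK_in.
by rewrite -[LHS](enum_valK_in gq) iq.
Qed.

Lemma regular_emb f : regular f ->
  exists p : {mpoly C[D]}, forall y, f (phi (emb y)) = p.@[y].
Proof.
have faP := @funalg_mpolyfun R D _ (@id ('I_D -> C)).
apply: (fa_regular (c := fun y => phi (emb y)) faP) => i j k.
apply: fa_phi => // q; apply: fa_sum => // l.
by exists 'X_l => y; rewrite mevalXU.
Qed.

End Dimension.

(** * Linear dependence of polynomials of bounded degree *)

Section Dependence.
Local Open Scope ring_scope.

Lemma card_bmultinom N k : (#|{: 'X_{1..N < k.+1}}| <= k.+1 ^ N)%N.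
Proof.
have le (m : 'X_{1..N < k.+1}) i : (m i < k.+1)%N.
  by apply: leq_ltn_trans (bmdeg m); rewrite mdegE (bigD1 i) //= leq_addr.
have := @leq_card _ _ (fun m : 'X_{1..N < k.+1} => [ffun i : 'I_N => inord (m i) : 'I_k.+1]).
rewrite card_ffun !card_ord; apply=> m1 m2 /ffunP m12; apply/val_inj/mnmP => i.
by have := m12 i; rewrite !ffunE => /(congr1 val); rewrite /= !inordK.
Qed.

(** The polynomials outnumber the monomials of degree at most k, so their coefficient matrix has a
    nonzero left kernel. *)
Lemma mpoly_dependent (F : fieldType) N k (I : finType) (p : I -> {mpoly F[N]}) :
  (forall i, (msize (p i) <= k.+1)%N) -> (k.+1 ^ N < #|I|)%N ->
  exists2 a : I -> F, \sum_i a i *: p i = 0 & exists i, a i != 0.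
Proof.
move=> pk Ik.
pose A : 'M[F]_(#|I|, #|{: 'X_{1..N < k.+1}}|) :=
  \matrix_(i, j) (p (enum_val i))@_(enum_val j : 'X_{1..N < k.+1}).
have : kermx A != 0.
  rewrite kermx_eq0 /row_free; apply: contraL Ik => /eqP <-; rewrite -leqNgt.
  exact: leq_trans (rank_leq_col _) (card_bmultinom _ _).
case/rowV0Pn=> v /sub_kermxP vA v0; exists (fun i => v 0 (enum_rank i)); last first.
  have /rV0Pn[i vi] := v0; by exists (enum_val i); rewrite enum_valK.
apply/mpolyP => m; rewrite mcoeff0 raddf_sum /=.
have [mk|km] := ltnP (mdeg m) k.+1; last first.
  rewrite big1 // => i _; rewrite mcoeffZ memN_msupp_eq0 ?mulr0 //.
  by apply: msize_mdeg_ge; apply: leq_trans km.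
transitivity ((v *m A) 0 (enum_rank (BMultinom mk))); last by rewrite vA mxE.
rewrite mxE (reindex _ (onW_bij _ (enum_val_bij I))) /=; apply: eq_bigr => i _.
by rewrite mcoeffZ enum_valK mxE enum_rankK.
Qed.

Lemma msize_mul (F : idomainType) N (p q : {mpoly F[N]}) a b :
  (msize p <= a.+1)%N -> (msize q <= b.+1)%N -> (msize (p * q) <= (a + b).+1)%N.
Proof.
have [->|p0] := eqVneq p 0; first by rewrite mul0r msize0.
have [->|q0] := eqVneq q 0; first by rewrite mulr0 msize0.
by rewrite msizeM //; lia.
Qed.

Lemma msize_exp (F : idomainType) N (p : {mpoly F[N]}) a j :
  (msize p <= a.+1)%N -> (msize (p ^+ j) <= (a * j).+1)%N.
Proof.
move=> pa; elim: j => [|j IH]; first by rewrite expr0 muln0 msize1.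
by rewrite exprS mulnS; apply: msize_mul.
Qed.

End Dependence.

(** * Upper bound for the length of chains *)

Section KrullDimension.
Local Open Scope ring_scope.
Variables (R : realType) (n : nat).
Local Notation C := (complex R).
Local Notation D := #|@good n|.

(** [G] consists of the monomials in f_1, ..., f_r with all exponents below m, where f_i vanishes on
    Z_(i-1) but not on Z_i; [lin_indep_powers] adds one f_i at a time. The choice of [e] before m
    makes the degree bound linear in m. *)
Lemma chain_monomials d (Z : nat -> sset R n) :
  (forall i, (i <= d)%N -> zclosed (Z i) /\ zirreducible (Z i)) ->
  (forall i, (i < d)%N -> ssubset (Z i) (Z i.+1) /\ ~ ssubset (Z i.+1) (Z i)) ->
  forall r, (r <= d)%N -> exists e, forall m, exists (I : finType) (G : I -> strc R n -> C),
    [/\ #|I| = (m ^ r)%N, forall i, regular (G i), lin_indep G (Z r) &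
     forall i, exists2 p : {mpoly C[D]}, (msize p <= (e * m).+1)%N &
       forall y, G i (phi (emb y)) = p.@[y]].
Proof.
move=> Zirr Zlt; elim=> [_|r IH rd].
  exists 0%N => m; exists unit, (fun _ _ => 1); split; first by rewrite card_unit.
  - by move=> _; apply: (fa_const (funalg_regular R n)).
  - move=> a a0 []; have [_ [[c Zc] _]] := Zirr 0%N isT.
    by have := a0 c Zc; rewrite (big_pred1 tt) ?mulr1 // => -[].
  - by move=> _; exists 1 => [|y]; rewrite ?msize1 ?meval1.
have [e eP] := IH (ltnW rd).
have [clZ irrZ] := Zirr r (ltnW rd); have [clZ' irrZ'] := Zirr r.+1 rd.
have [subZ /not_ssubset[c Zc nZc]] := Zlt r rd.
have [f [rf f0 fc]] := zclosed_sep clZ nZc.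
have [p pf] := regular_emb rf.
exists (e + msize p)%N => m; have [I [G [cI rG indG pG]]] := eP m.
exists (I * 'I_m)%type, (fun (q : I * 'I_m) c => G q.1 c * f c ^+ q.2); split.
- by rewrite card_prod cI card_ord expnSr.
- move=> q; apply: (fa_mul (funalg_regular R n)) => //.
  by apply: fa_exp => //; apply: funalg_regular.
- by apply: lin_indep_powers indG => // f0'; apply: fc; apply: f0'.
case=> i j /=; have [q qs qE] := pG i; exists (q * p ^+ j) => [|y].
  rewrite mulnDl; apply: msize_mul => //.
  apply: leq_trans (msize_exp j (leqnSn _)) _.
  by rewrite ltnS leq_mul2l (ltnW (ltn_ord j)) orbT.
by rewrite mevalM rmorphXn /= qE pf.
Qed.

(** There are m^(D+1) independent monomials, while their pullbacks lie in a space of dimension at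
    most (e m + 1)^D <= ((e + 1) m)^D, which is smaller once m > (e + 1)^D. The resulting relation
    holds on the image of [phi], hence on Nil_n by density, against independence on the last member
    of the chain. *)
Lemma not_irr_chain_NilV : ~ irr_chain (@NilV R n) D.+1.
Proof.
move=> [Z [Zirr Zlt]].
have Zirr' i : (i <= D.+1)%N -> zclosed (Z i) /\ zirreducible (Z i) by case/Zirr.
have [e eP] := chain_monomials Zirr' Zlt (leqnn _).
pose m := (e.+1 ^ D).+1; have [I [G [cI rG indG pG]]] := eP m.
have [p ps pE] := fin_all_exists2 pG.
have [|a a0 [i /eqP]] := mpoly_dependent ps.
  have km : ((e * m).+1 <= e.+1 * m)%N by rewrite mulSn addnC -addn1 leq_add2l.
  rewrite cI; apply: (@leq_ltn_trans ((e.+1 * m) ^ D)).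
    by case: #|_| => // N; rewrite leq_exp2r.
  by rewrite expnMn expnSr mulnC ltn_pmul2l ?expn_gt0.
apply; apply: indG => c Zc.
have cN : nilpotent c by have [_ _] := Zirr _ (leqnn _); apply.
apply: (phi_dense (f := fun c => \sum_i a i * G i c)) cN => [|x].
  apply: (fa_sum (funalg_regular R n)) => l; apply: (fa_mul (funalg_regular R n)) => //.
  exact: (fa_const (funalg_regular R n)).
have [y ->] := phi_emb x; rewrite -[RHS](meval0 y) -a0 raddf_sum /=.
by apply: eq_bigr => l _; rewrite mevalZ -pE.
Qed.

Lemma zdim_NilV : zdim (@NilV R n) ((n * (n - 1) * (n + 1)) %/ 3).
Proof. by rewrite -card_good; split; [apply: irr_chain_NilV|apply: not_irr_chain_NilV]. Qed.

End KrullDimension.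

Theorem theoremA :
  (forall (R : realType) (n : nat), (3 <= n)%N -> generic (@Rfam R n) (@NilV R n)) /\
  (forall (R : realType) (n : nat), (2 <= n)%N ->
     zirreducible (@NilV R n) /\ zdim (@NilV R n) ((n * (n - 1) * (n + 1)) %/ 3)).
Proof.
split=> R n n_ge; first exact: generic_Rfam.
split; last exact: zdim_NilV.
by rewrite zclosure_phi; exact: zirreducible_phi.
Qed.
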